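(* Let $\lambda=(\lambda_1\geq\cdots\geq\lambda_p\geq 0)$ and $\mu=(\mu_1\geq\cdots\geq\mu_p\geq 0)$ be partitions, and let $$c(\lambda,\mu)=\sum_{s\in S(\lambda)}\det M(s),$$ where $S(\lambda)$ and $M(s)$ are as defined in the context. The coefficient $c(\lambda,\mu)$ is positive if $p\leq 3$. Moreover, it is conjectured (not proved) that $c(\lambda,\mu)$ is positive for all $p$.
   Context: A path is a lattice path in $\mathbb{Z}^2$ whose horizontal steps go to the right and whose vertical steps go down (unit steps $(1,0)$ and $(0,-1)$). For $A,B\in\mathbb{Z}^2$, $\mathcal{P}(A\to B)$ is the set of paths starting at $A$ and ending at $B$. A partition is a weakly decreasing sequence of $p$ nonnegative integers. Triangular sequences: $S(\lambda)$ is the set of all families $s=(a_{i,j})_{1\leq j\leq i\leq p-1}$ of nonnegative integers such that (1) $0\leq a_{i,j}\leq\lambda_{j+1}$ for all $1\leq j\leq i\leq p-1$; (2) for all $j$ and all $1\leq i\leq p-1-j$, $a_{j+1,j}+\cdots+a_{j+i,j}\leq a_{j,j}$. For $s=(a_{i,j})\in S(\lambda)$ put $R_j=a_{j,1}+\cdots+a_{j,j-1}$ for $2\leq j\leq p-1$ and $R_1=0$; put $C_j=a_{j+1,j}+\cdots+a_{p-1,j}$ for $1\leq j\leq p-2$ and $C_{p-1}=0$. Lattice points: for $1\leq j\leq p$, $B_j=(\mu_j+p-j+1,\ \mu_j+p-j+1)$. For $1\leq j\leq p-1$, $$A_j(s)=(p-j+1+a_{j,j}-R_j,\ \lambda_j+p-j+1-R_j),$$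 and $A_p(s)=(x,\ \lambda_p+x)$ with $x=1+\sum_{j=1}^{p-1}(C_j-a_{j,j})$. $M(s)$ is the $p\times p$ matrix with entries $m_{ij}(s)=\#\mathcal{P}(A_i(s)\to B_j)$. *)

(* Defs.v *)
From mathcomp Require Import all_boot all_order all_algebra.

Set Implicit Arguments.
Unset Strict Implicit.
Unset Printing Implicit Defensive.

Import GRing.Theory Num.Theory.

Local Open Scope ring_scope.

(* All indices i, j below are natural numbers starting from 1, as in the
   mathematical notation (an ordinal index in [tri] stands for its value); only
   tuples and matrices are indexed from 0. *)

Definition is_partition (p : nat) (la : p.-tuple nat) : bool := sorted geq la.

Definition part (p : nat) (la : p.-tuple nat) (j : nat) : nat := nth 0%N la j.-1.

(* A unit step: [true] goes right, [false] goes down. *)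
Definition move (P : int * int) (b : bool) : int * int :=
  if b then (P.1 + 1, P.2) else (P.1, P.2 - 1).

(* A path is given by its starting point and its sequence of steps. *)
Definition path_end (A : int * int) (s : seq bool) : int * int := foldl move A s.

Definition path_length (A B : int * int) : nat := (absz (B.1 - A.1) + absz (A.2 - B.2))%N.

(* Restricting the step sequences to length [path_length A B] loses nothing, by
   [size_path] below; it only makes the set of paths a finite set. *)
Definition paths (A B : int * int) : {set (path_length A B).-tuple bool} :=
  [set s : (path_length A B).-tuple bool | path_end A s == B].

Lemma path_endE (A : int * int) (s : seq bool) :
  path_end A s = (A.1 + (count id s)%:Z, A.2 - (count negb s)%:Z).
Proof.
rewrite /path_end; elim: s A => [|b s IHs] [x y] /=; first by rewrite addr0 subr0.
rewrite IHs; case: b => /=; rewrite ?add0n ?add1n -?natz.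
  by rewrite -[in RHS]addn1 natrD addrA addrAC.
by rewrite -[in RHS]addn1 natrD opprD addrA addrAC.
Qed.

Lemma size_path (A B : int * int) (s : seq bool) :
  path_end A s = B -> size s = path_length A B.
Proof.
rewrite path_endE => <-; rewrite /path_length /= addrC addKr opprB addrCA subrr addr0.
by rewrite !absz_nat -(count_predC id s).
Qed.

(* The pairs (i, j) with 1 <= j <= i <= p - 1. *)
Definition tri (p : nat) := {ij : 'I_p * 'I_p | (0 < ij.2 <= ij.1)%N}.

(* Families bounded by la_1: since la is weakly decreasing, the condition
   a_{i,j} <= la_{j+1} defining triseq makes this bound automatic. *)
Definition family (p : nat) (la : p.-tuple nat) :=
  {ffun tri p -> 'I_(part la 1).+1}.

(* The entry a_{i,j}; the value 0 outside 1 <= j <= i <= p - 1 is never used. *)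
Definition entry (p : nat) (la : p.-tuple nat) (s : family la) (i j : nat) : nat :=
  if [pick t : tri p | ((val t).1 == i :> nat) && ((val t).2 == j :> nat)] is Some t
  then s t else 0%N.

Definition triseq (p : nat) (la : p.-tuple nat) : {set family la} :=
  [set s : family la |
     [forall t : tri p, (s t <= part la (val t).2.+1)%N] &&
     [forall j : 'I_p, forall i : 'I_p,
        (0 < j)%N && (0 < i)%N && (i + j <= p.-1)%N ==>
        (\sum_(1 <= k < i.+1) entry s (j + k) j <= entry s j j)%N]].

(* R_1 = 0 and C_{p-1} = 0 as empty sums. *)
Definition Rsum (p : nat) (la : p.-tuple nat) (s : family la) (j : nat) : nat :=
  (\sum_(1 <= k < j) entry s j k)%N.

Definition Csum (p : nat) (la : p.-tuple nat) (s : family la) (j : nat) : nat :=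
  (\sum_(j.+1 <= k < p) entry s k j)%N.

Definition pointA (p : nat) (la : p.-tuple nat) (s : family la) (j : nat) : int * int :=
  if (j < p)%N then
    (p%:Z - j%:Z + 1 + (entry s j j)%:Z - (Rsum s j)%:Z,
     (part la j)%:Z + p%:Z - j%:Z + 1 - (Rsum s j)%:Z)
  else
    let x : int := 1 + \sum_(1 <= k < p) ((Csum s k)%:Z - (entry s k k)%:Z) in
    (x, (part la p)%:Z + x).

Definition pointB (p : nat) (mu : p.-tuple nat) (j : nat) : int * int :=
  ((part mu j)%:Z + p%:Z - j%:Z + 1, (part mu j)%:Z + p%:Z - j%:Z + 1).

Definition M (p : nat) (la mu : p.-tuple nat) (s : family la) : 'M[int]_p :=
  \matrix_(i < p, j < p) (#|paths (pointA s i.+1) (pointB mu j.+1)|)%:Z.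

Definition coef (p : nat) (la mu : p.-tuple nat) : int :=
  \sum_(s in triseq la) \det (M mu s).

(* Main.v *)
Require Import Defs.
From mathcomp Require Import all_boot all_order all_algebra.
From mathcomp Require Import fingroup perm zify ring.

(** All end points lie on the diagonal, so the entries of the determinants are
    the numbers N(x, n; b) = C(n, b - x) of paths from (x, x + n) to (b, b).
    Sorting the paths by their first step gives the Pascal rule
    N(x, n + 1) = N(x, n) + N(x + 1, n), and with it the positivity statement on
    which everything rests ([det_diag_paths_ge0]): the determinant is nonnegative
    as soon as both coordinates of the starting points decrease weakly with the
    row index. This is the Lindstrom-Gessel-Viennot lemma for such starting
    points, but the proof below is purely algebraic.

    For p = 1 and p = 2 the starting points of every M(s) are in this order, and
    each term of c(lambda, mu) is nonnegative. For p = 3 write a, b, c for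
    a_11, a_21, a_22; the starting points are
      (3 + a, lambda_1 + 3), (2 + c - b, lambda_2 + 2 - b),
      (1 + b - a - c, lambda_3 + 1 + b - a - c)
    with b <= a <= lambda_2 and c <= lambda_3. The first point may lie to the left
    of the second when c > a + b + 1, and the second to the left of the third when
    2 b > a + 2 c + 1; single terms can then be negative. The two defects are repaired separately, on the terms with b < c and on those with
    c <= b, by cancellations inside each part.

    If b < c ([sum_det_b_lt_c_ge0]), fix b and let the first path run down to the
    height lambda_2 + 2 - b of the second starting point. If it arrives there at
    (2 + e - b, lambda_2 + 2 - b) with e <= lambda_3, after a given number k of
    steps to the right, the two rows have starting points of the same shape, with
    parameters e and c, while the third starting point depends only on e + c. The
    resulting determinant is antisymmetric in (e, c), and the range of (e, c)
    consists of a square, on which the sum vanishes, together with a rectangle in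
    which e > c, where the points are in order. The paths that are still higher
    when they cross the corresponding vertical line can be restarted from that
    line, where the points are in order too.

    If c <= b ([sum_det_c_le_b_ge0]), fix a and c. The second and third starting
    points lie on the diagonals y - x = lambda_2 - c and y - x = lambda_3; let the
    path from the higher diagonal run down to the lower one, which it reaches after
    k steps to the right. With both points on one diagonal the determinant changes
    sign when they are exchanged, and the exchange amounts to a reflection of b.
    For each k, the reflection preserves the interval of those b that are at least
    2 c + 1 + k (respectively 2 c + 1 - k), so these terms cancel. What remains has
    its points in order, possibly after restarting the second path from a vertical
    line. *)

Set Implicit Arguments.
Unset Strict Implicit.
Unset Printing Implicit Defensive.

Import Order.TTheory GRing.Theory Num.Theory.

Local Open Scope ring_scope.

(** * Counting paths that end on the diagonal *)

(** The number of paths from [(x, x + n)] to [(b, b)], by [card_paths]; also the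
    coefficient of [t ^ b] in [t ^ x * (1 + t) ^ n]. *)
Definition diag_paths (x : int) (n : nat) (b : int) : int :=
  if x <= b then 'C(n, absz (b - x)%R)%:Z else 0.

Lemma diag_paths_pascal x n b :
  diag_paths x n.+1 b = diag_paths x n b + diag_paths (x + 1) n b.
Proof.
rewrite /diag_paths; have [lxb|ltbx|->] := ltrgtP x b.
- have -> : (x + 1 <= b) = true by lia.
  have -> : absz (b - x)%R = (absz (b - (x + 1))%R).+1 by lia.
  by rewrite binS; lia.
- by have -> : (x + 1 <= b) = false by lia.
- have -> : (b + 1 <= b) = false by lia.
  by rewrite subrr !bin0 addr0.
Qed.

Lemma card_count_tuple n k : #|[set s : n.-tuple bool | count id s == k]| = 'C(n, k).
Proof.
rewrite -[in RHS](card_ord n) -card_draws.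
pose f (A : {set 'I_n}) := [tuple i \in A | i < n].
have f_inj : injective f.
  move=> A B eqAB; apply/setP => i.
  by have := congr1 (fun s => tnth s i) eqAB; rewrite !tnth_mktuple.
rewrite -(card_imset _ f_inj); apply: eq_card => s; rewrite !inE.
have cnt A : count id (f A) = #|A|.
  by rewrite /= count_map cardE -size_filter enumT.
apply/idP/imsetP => [/eqP cs | [A]]; last first.
  by rewrite inE => /eqP <- ->; rewrite cnt.
have def_s : s = f [set i | tnth s i].
  by apply: eq_from_tnth => i; rewrite tnth_mktuple inE.
by exists [set i | tnth s i]; rewrite // inE -cnt -def_s cs.
Qed.

Lemma card_paths (x : int) (n : nat) (b : int) :
  (#|paths (x, x + n%:Z) (b, b)|)%:Z = diag_paths x n b.
Proof.
rewrite /diag_paths; case: ifP => [lexb|ltbx]; last first.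
  rewrite (eq_card0 (A := paths _ _)) // => s; rewrite inE path_endE /=.
  by apply/negbTE/eqP => -[]; lia.
have [lebn|ltnb] := leP b (x + n%:Z); last first.
  rewrite bin_small; last by lia.
  rewrite (eq_card0 (A := paths _ _)) // => s; rewrite inE path_endE /=.
  by apply/negbTE/eqP => -[]; lia.
have lenE : path_length (x, x + n%:Z) (b, b) = n by rewrite /path_length /=; lia.
rewrite /paths lenE -card_count_tuple; congr (Posz _); apply: eq_card => s.
rewrite !inE path_endE /=.
have : (count id s + count negb s)%N = n by rewrite (count_predC id) size_tuple.
move: (count id s) (count negb s) => h v sum_hv.
by apply/eqP/eqP => [[]|e]; [|congr pair]; lia.
Qed.

(** A strictly increasing permutation moves no index down, and neither does its
    inverse. *)
Lemma increasing_perm p (s : 'S_p) : {homo s : i j / (i < j)%N} -> s = 1%g.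
Proof.
move=> s_incr.
have ge_id (u : 'S_p) : {homo u : i j / (i < j)%N} -> forall i : 'I_p, (i <= u i)%N.
  move=> u_incr [i lt_ip]; elim: i lt_ip => [//|i IHi] lt_ip.
  apply: leq_ltn_trans (IHi (ltnW lt_ip)) _; exact: u_incr.
apply/permP => i; rewrite perm1; apply/val_inj/eqP; rewrite eqn_leq ge_id // andbT.
rewrite -{2}(permK s i); apply: (ge_id) => j k lt_jk.
case: ltngtP => // [|/val_inj/perm_inj eq_jk]; last by rewrite eq_jk ltnn in lt_jk.
by move/s_incr; rewrite !permKV ltnNge ltnW.
Qed.

Definition diag_paths_mx p (x : 'I_p -> int) (n : 'I_p -> nat) (b : 'I_p -> int) :
    'M[int]_p :=
  \matrix_(i, j) diag_paths (x i) (n i) (b j).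

(** By induction on the sum of the [n i]. If two rows start at the same point the
    determinant is 0. Otherwise apply the Pascal rule to a row with [n i] maximal:
    a step to the right (or down) keeps the points in order, since the only
    obstruction would be a point straight above (or straight to the left), and at
    that point [n] would be larger. When all [n i] are 0, every entry is 0 or 1 and
    only the identity contributes to the Leibniz formula. *)
Lemma det_diag_paths_ge0 p (x : 'I_p -> int) (n : 'I_p -> nat) (b : 'I_p -> int) :
    (forall i j : 'I_p, (i < j)%N -> x j <= x i /\ x j + (n j)%:Z <= x i + (n i)%:Z) ->
    (forall i j : 'I_p, (i < j)%N -> b j < b i) ->
  0 <= \det (diag_paths_mx x n b).
Proof.
move=> + b_decr; have [m] := ubnP (\sum_i n i)%N; elim: m => // m IHm in x n *.
move=> lt_nm ord_xn.
have [/existsP[i /existsP[j /and3P[neq_ij /eqP eq_x /eqP eq_n]]]|distinct] :=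
    boolP [exists i, exists j, [&& i != j, x i == x j & n i == n j]].
  by rewrite (determinant_alternate neq_ij) // => k; rewrite !mxE eq_x eq_n.
have {}distinct i j : i != j -> x i = x j -> n i = n j -> False.
  move=> neq_ij eq_x eq_n; case/negP: distinct.
  by apply/existsP; exists i; apply/existsP; exists j; rewrite neq_ij eq_x eq_n !eqxx.
have [n0|/forallPn[i0 n_i0]] := boolP [forall i, n i == 0]%N.
  rewrite sumr_ge0 // => s _; case: (altP (s =P 1%g)) => [->|neq_s1].
    by rewrite odd_perm1 mul1r prodr_ge0 // => i _; rewrite mxE /diag_paths; case: ifP.
  have [/existsP[i /eqP i0]|/existsPn allN0] :=
      boolP [exists i, diag_paths_mx x n b i (s i) == 0].
    by rewrite (bigD1 i) //= i0 mul0r mulr0.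
  have x_bs i : x i = b (s i).
    have := allN0 i; rewrite mxE /diag_paths (eqP (forallP n0 i)).
    by case: ifP => // le_xb; case dist0: (absz _) => [|//] _; lia.
  case/eqP: neq_s1; apply: increasing_perm => i j lt_ij.
  have := (ord_xn i j lt_ij).1; rewrite !x_bs => le_b.
  case: (ltngtP (s i) (s j)) => // [/b_decr|/val_inj/perm_inj eq_ij]; first by lia.
  by rewrite eq_ij ltnn in lt_ij.
have [i _ n_max] := arg_maxnP n (erefl true : xpredT i0).
have n_gt0 : (0 < n i)%N by apply: leq_trans (n_max i0 isT); rewrite lt0n.
pose xr k := if k == i then x i + 1 else x k.
pose nd k := if k == i then (n i).-1 else n k.
have lt_ndm : (\sum_k nd k < m)%N.
  apply: leq_trans (_ : \sum_k n k <= m)%N => //.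
  rewrite (bigD1 i) //= [leqRHS](bigD1 i) //= -addSn.
  rewrite /nd eqxx prednK // leq_add2l; apply: leq_sum => k /negbTE->.
  exact: leqnn.
have -> : \det (diag_paths_mx x n b) =
    1 * \det (diag_paths_mx x nd b) + 1 * \det (diag_paths_mx xr nd b).
  apply: (determinant_multilinear (i0 := i)).
  - apply/rowP => j; rewrite !mxE /xr /nd eqxx !mul1r -diag_paths_pascal.
    by rewrite prednK.
  - by apply/matrixP => k j; rewrite !mxE /nd eq_sym (negbTE (neq_lift _ _)).
  - by apply/matrixP => k j; rewrite !mxE /xr /nd eq_sym (negbTE (neq_lift _ _)).
rewrite !mul1r addr_ge0 //; apply: IHm => // j k lt_jk; have := ord_xn j k lt_jk;
  have neq_jk : j != k by rewrite -val_eqE /=; lia.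
- rewrite /nd.
  case: (eqVneq j i) => [eq_ji|neq_ji]; case: (eqVneq k i) => [eq_ki|neq_ki].
  + by rewrite eq_ji eq_ki eqxx in neq_jk.
  + rewrite eq_ji => -[le_x le_y]; split=> //.
    have := n_max k isT; have := @distinct i k; rewrite eq_sym neq_ki => /(_ isT) di ge_n.
    have [eqx|] := eqVneq (x i) (x k); last by lia.
    have [eqn|] := eqVneq (n i) (n k); first by case: (di eqx eqn).
    by lia.
  + by rewrite eq_ki => -[]; lia.
  + by [].
- rewrite /nd /xr.
  case: (eqVneq j i) => [eq_ji|neq_ji]; case: (eqVneq k i) => [eq_ki|neq_ki].
  + by rewrite eq_ji eq_ki eqxx in neq_jk.
  + by rewrite eq_ji => -[]; lia.
  + rewrite eq_ki => -[le_x le_y]; have := n_max j isT.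
    have := @distinct j i neq_ji => di ge_n.
    have [eqx|] := eqVneq (x j) (x i); last by lia.
    have [eqn|] := eqVneq (n j) (n i); first by case: (di eqx eqn).
    by lia.
  + by [].
Qed.

(** * Weighted sums governed by the Pascal rule *)

(** The first-step rule satisfied by any linear functional of the row
    [diag_paths x n], such as a determinant in which the other rows are fixed. *)
Definition pascal (phi : int -> nat -> int) :=
  forall x n, phi x n.+1 = phi x n + phi (x + 1) n.

Lemma sum_bin_row d r (F : nat -> int) :
  \sum_(0 <= k < r.+1) 'C(d.+1, k)%:Z * F k =
  \sum_(0 <= k < r.+1) 'C(d, k)%:Z * F k + \sum_(0 <= k < r) 'C(d, k)%:Z * F k.+1.
Proof.
rewrite !big_nat_recl // !bin0 -addrA -big_split /=; congr (_ + _).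
by apply: eq_bigr => k _; rewrite binS PoszD mulrDl.
Qed.

Lemma sum_bin_diag d r (F : nat -> int) :
  \sum_(0 <= k < r.+1) 'C(d.+1 + k, k)%:Z * F k =
  \sum_(0 <= k < r.+1) 'C(d + k, k)%:Z * F k +
  \sum_(0 <= k < r) 'C(d.+1 + k, k)%:Z * F k.+1.
Proof.
rewrite !big_nat_recl // !bin0 -addrA -big_split /=; congr (_ + _).
by apply: eq_bigr => k _; rewrite addSn binS PoszD mulrDl -addSnnS.
Qed.

(** Every step brings the path closer by 1 to the final diagonal. It is cut after
    [d] steps, [k] of them to the right, when it is at distance [n]. *)
Lemma pascal_expand phi x n d : pascal phi ->
  phi x (n + d)%N = \sum_(0 <= k < d.+1) 'C(d, k)%:Z * phi (x + k%:Z) n.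
Proof.
move=> phiP; elim: d x => [|d IHd] x.
  by rewrite addn0 big_nat1 bin0 mul1r addr0.
rewrite addnS phiP !IHd sum_bin_row; congr (_ + _).
  by rewrite [RHS]big_nat_recr //= bin_small // mul0r addr0.
by apply: eq_bigr => k _; rewrite -addrA.
Qed.

(** The paths with [k < r] steps to the right among the first [d] are kept and cut
    after [d] steps; all the others reach the abscissa [x + r] within these [d] steps
    and can be restarted there, at distance at least [n] from the final diagonal. *)
Lemma pascal_diag_cut phi x n d r : pascal phi ->
    (forall j, (j + r <= d)%N -> 0 <= phi (x + r%:Z) (n + j)%N) ->
  \sum_(0 <= k < r) 'C(d, k)%:Z * phi (x + k%:Z) n <= phi x (n + d)%N.
Proof.
move=> phiP; elim: d x r => [|d IHd] x [|r] rest_ge0.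
- by rewrite big_geq //; have := rest_ge0 0%N isT; rewrite addr0.
- rewrite big_nat_recl // big1 => [|k _]; last by rewrite bin0n mul0r.
  by rewrite bin0 addn0 mul1r !addr0.
- by rewrite big_geq //; have := rest_ge0 d.+1; rewrite addn0 addr0 => ->.
rewrite addnS phiP sum_bin_row lerD //.
  by apply: IHd => j le_d; apply: rest_ge0; lia.
rewrite (eq_bigr (fun k => 'C(d, k)%:Z * phi (x + 1 + k%:Z) n)) => [|k _].
  by apply: IHd => j le_d; rewrite -addrA; apply: rest_ge0; lia.
by rewrite -addrA.
Qed.

(** The path starts at height [x + q + d] and is cut where it first reaches the
    height [x + q - 1]. With [k < m] steps to the right it does so at
    [(x + k, x + q - 1)], after [d + k] steps followed by a step down. All the other
    paths meet the vertical line through [x + m] while still at height at least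
    [x + q], and can be restarted there. *)
Lemma pascal_level_cut phi x q d m : pascal phi -> (m <= q)%N ->
    (forall n, (q <= n + m)%N -> 0 <= phi (x + m%:Z) n) ->
  \sum_(0 <= k < m) 'C(d + k, k)%:Z * phi (x + k%:Z) (q - k.+1)%N <= phi x (q + d)%N.
Proof.
move=> phiP; elim: m x q d => [|m IHm] x q d le_mq rest_ge0.
  by rewrite big_geq //; have := rest_ge0 (q + d)%N; rewrite addr0 addn0 leq_addr => ->.
case: q => // q in le_mq rest_ge0 *.
have right_step d' : \sum_(0 <= k < m) 'C(d' + k, k)%:Z * phi (x + k.+1%:Z) (q - k.+1)%N
    <= phi (x + 1) (q + d')%N.
  rewrite (eq_bigr (fun k => 'C(d' + k, k)%:Z * phi (x + 1 + k%:Z) (q - k.+1)%N)).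
    by apply: IHm => // n le_qn; rewrite -addrA; apply: rest_ge0; lia.
  by move=> k _; rewrite -addrA.
elim: d => [|d IHd].
  rewrite addn0 phiP big_nat_recl // bin0 mul1r addr0 subSS subn0 lerD2l.
  rewrite -[q in leRHS]addn0; apply: le_trans _ (right_step 0%N).
  rewrite le_eqVlt; apply/orP; left; apply/eqP.
  by apply: eq_bigr => k _; rewrite !add0n !binn subSS.
rewrite addnS phiP sum_bin_diag lerD //.
by rewrite addSn -addnS; apply: right_step.
Qed.

(** * Determinants of three rows *)

Definition sel3 (T : Type) (u v w : T) (i : 'I_3) : T := nth u [:: u; v; w] i.

Definition det_paths3 (b : 'I_3 -> int) x1 n1 x2 n2 x3 n3 : int :=
  \det (diag_paths_mx (sel3 x1 x2 x3) (sel3 n1 n2 n3) b).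

Lemma det_paths3E b x1 n1 x2 n2 x3 n3 :
  let m x n j := diag_paths x n (b (inord j)) in
  det_paths3 b x1 n1 x2 n2 x3 n3 =
    m x1 n1 0 * (m x2 n2 1 * m x3 n3 2 - m x2 n2 2 * m x3 n3 1)
  - m x1 n1 1 * (m x2 n2 0 * m x3 n3 2 - m x2 n2 2 * m x3 n3 0)
  + m x1 n1 2 * (m x2 n2 0 * m x3 n3 1 - m x2 n2 1 * m x3 n3 0).
Proof.
move=> m; rewrite /det_paths3 (expand_det_row _ ord0) /cofactor.
rewrite !(big_ord_recl, big_ord0) /= !(expand_det_row _ ord0) /cofactor.
rewrite !(big_ord_recl, big_ord0) /= !det_mx11 !mxE /sel3 /=.
have eq_m x n (j : 'I_3) : diag_paths x n (b j) = m x n j by rewrite /m inord_val.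
by rewrite !eq_m /=; ring.
Qed.

Lemma det_paths3_pascal1 b x2 n2 x3 n3 : pascal (fun x n => det_paths3 b x n x2 n2 x3 n3).
Proof. by move=> x n; rewrite !det_paths3E /= !diag_paths_pascal; ring. Qed.

Lemma det_paths3_pascal2 b x1 n1 x3 n3 : pascal (fun x n => det_paths3 b x1 n1 x n x3 n3).
Proof. by move=> x n; rewrite !det_paths3E /= !diag_paths_pascal; ring. Qed.

Lemma det_paths3_pascal3 b x1 n1 x2 n2 : pascal (fun x n => det_paths3 b x1 n1 x2 n2 x n).
Proof. by move=> x n; rewrite !det_paths3E /= !diag_paths_pascal; ring. Qed.

Lemma det_paths3_swap12 b x1 n1 x2 n2 x3 n3 :
  det_paths3 b x2 n2 x1 n1 x3 n3 = - det_paths3 b x1 n1 x2 n2 x3 n3.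
Proof. by rewrite !det_paths3E /=; ring. Qed.

Lemma det_paths3_swap23 b x1 n1 x2 n2 x3 n3 :
  det_paths3 b x1 n1 x3 n3 x2 n2 = - det_paths3 b x1 n1 x2 n2 x3 n3.
Proof. by rewrite !det_paths3E /=; ring. Qed.

Lemma det_paths3_ge0 (b : 'I_3 -> int) x1 (n1 : nat) x2 (n2 : nat) x3 (n3 : nat) :
    (forall i j : 'I_3, (i < j)%N -> b j < b i) ->
    x3 <= x2 <= x1 -> x3 + n3%:Z <= x2 + n2%:Z <= x1 + n1%:Z ->
  0 <= det_paths3 b x1 n1 x2 n2 x3 n3.
Proof.
move=> b_decr /andP[le32 le21] /andP[le32' le21'].
apply: det_diag_paths_ge0 => // -[[|[|[|//]]] ?] [[|[|[|//]]] ?] //= _.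
all: by rewrite /sel3 /=; lia.
Qed.

(** * Sums of antisymmetric functions *)

(** The box is a square with the two sides equal to the interval from [i0] to [n],
    whose sum vanishes, and a rectangle in which [f < i0 <= e]. *)
Lemma antisym_box_ge0 i0 j0 n (g : nat -> nat -> int) : (j0 <= i0)%N ->
    (forall e f, g e f = - g f e) ->
    (forall e f, (i0 <= e < n)%N -> (j0 <= f < i0)%N -> 0 <= g e f) ->
  0 <= \sum_(i0 <= e < n) \sum_(j0 <= f < n) g e f.
Proof.
move=> le_j0i0 g_anti g_ge0.
have [le_ni|lt_in] := leqP n i0; first by rewrite big_geq.
have square0 : \sum_(i0 <= e < n) \sum_(i0 <= f < n) g e f = 0.
  set t := LHS; suff: t = - t by lia.
  rewrite {1}/t exchange_big -sumrN; apply: eq_bigr => e _.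
  by rewrite -sumrN; apply: eq_bigr => f _; rewrite -g_anti.
rewrite (eq_bigr (fun e => \sum_(j0 <= f < i0) g e f + \sum_(i0 <= f < n) g e f)).
  rewrite big_split /= square0 addr0 big_nat sumr_ge0 // => e ran_e.
  by rewrite big_nat sumr_ge0 // => f ran_f; apply: g_ge0.
by move=> e _; rewrite (big_cat_nat le_j0i0) // ltnW.
Qed.

Lemma sum_antisym_nat m n (f : nat -> int) :
  (forall i, (m <= i < n)%N -> f (m + n - i.+1)%N = - f i) -> \sum_(m <= i < n) f i = 0.
Proof.
move=> f_anti; set t := LHS; suff: t = - t by lia.
by rewrite {1}/t big_nat_rev -sumrN /=; apply: eq_big_nat.
Qed.

(** The inner sums are exchanged so that, for each [k], the interval from [s k] to
    [a] is summed over [b]: its reflection is [b |-> s k + a - b]. *)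
Lemma sum_antisym_triangle_nat a c r (s : nat -> nat) (g : nat -> nat -> int) :
    (forall k, (k < r)%N -> (c <= s k)%N) ->
    (forall k b, (k < r)%N -> (s k <= b <= a)%N -> g k (s k + a - b)%N = - g k b) ->
  \sum_(c <= b < a.+1) \sum_(0 <= k < r | (s k <= b)%N) g k b = 0.
Proof.
move=> le_cs g_anti; rewrite (exchange_big_dep xpredT) //= big_nat big1 // => k ran_k.
rewrite -(big_nat_widenl (s k) c _ xpredT); last exact: le_cs.
apply: sum_antisym_nat => b ran_b; rewrite -g_anti //; congr g; lia.
Qed.

(** * The sum over the triangular sequences for three rows *)

(** [a], [b], [c] stand for the entries a_11, a_21, a_22 of a triangular sequence. *)
Definition det_abc (be : 'I_3 -> int) (l1 l2 l3 a b c : nat) : int :=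
  det_paths3 be (3 + a%:Z) (l1 - a)%N (2 + c%:Z - b%:Z) (l2 - c)%N
                (1 + b%:Z - a%:Z - c%:Z) l3.

Section ThreeRows.
Variables (be : 'I_3 -> int) (l1 l2 l3 : nat).
Hypotheses (be_decr : forall i j : 'I_3, (i < j)%N -> be j < be i).
Hypotheses (le_l21 : (l2 <= l1)%N) (le_l32 : (l3 <= l2)%N).

Notation T := (det_abc be l1 l2 l3).

(** The only possible defect in the order of the points is that the first one is to
    the left of the second. The first path is cut at the height of the second point
    as long as it stays at abscissa at most [2 + l3 - b], the largest abscissa of a
    second point. *)
Lemma sum_det_b_lt_c_ge0 b :
  0 <= \sum_(b <= a < l2.+1) \sum_(b.+1 <= c < l3.+1) T a b c.
Proof.
(* With [e = a + b + k + 1] the first path is cut at abscissa [3 + a + k = 2 + e - b],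
   and its distance [l2 - e] to the diagonal has the form of [l2 - c]. *)
pose g k e f := 'C(l1 - l2 + b + k, k)%:Z *
  det_paths3 be (2 + e%:Z - b%:Z) (l2 - e)%N (2 + f%:Z - b%:Z) (l2 - f)%N
                (2 + b%:Z + b%:Z + k%:Z - e%:Z - f%:Z) l3.
have cut a c : (b <= a < l2.+1)%N -> (b.+1 <= c < l3.+1)%N ->
    \sum_(0 <= k < l3 - b - a) g k (a + (b + k).+1)%N c <= T a b c.
  move=> ran_a ran_c.
  have rest_ge0 m n : (l3 <= b + a + m)%N -> (l2 <= n + m + b + a)%N ->
      0 <= det_paths3 be (3 + a%:Z + m%:Z) n (2 + c%:Z - b%:Z) (l2 - c)%N
                (1 + b%:Z - a%:Z - c%:Z) l3.
    by move=> le_m le_n; apply: det_paths3_ge0 => //; lia.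
  have [no_cut|some_cut] := leqP (l3 - b) a.
    rewrite big_geq; last by lia.
    have := rest_ge0 0%N (l1 - a)%N; rewrite addr0; apply; lia.
  have -> : T a b c = det_paths3 be (3 + a%:Z) (l2 - b - a + (l1 - l2 + b))%N
      (2 + c%:Z - b%:Z) (l2 - c)%N (1 + b%:Z - a%:Z - c%:Z) l3.
    by congr det_paths3; lia.
  rewrite (eq_big_nat _ _ (F2 := fun k => 'C(l1 - l2 + b + k, k)%:Z *
      det_paths3 be (3 + a%:Z + k%:Z) (l2 - b - a - k.+1)%N (2 + c%:Z - b%:Z) (l2 - c)%N
                (1 + b%:Z - a%:Z - c%:Z) l3)) => [|k ran_k]; last first.
    by rewrite /g; congr (_ * det_paths3 _ _ _ _ _ _ _); lia.
  apply: (pascal_level_cut _ (det_paths3_pascal1 _ _ _ _ _)) => [|n le_n]; first by lia.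
  by apply: rest_ge0; lia.
apply: le_trans (_ : \sum_(b <= a < l2.+1) \sum_(b.+1 <= c < l3.+1)
    \sum_(0 <= k < l3 - b - a) g k (a + (b + k).+1)%N c <= _); last first.
  rewrite !big_nat; apply: ler_sum => a ran_a.
  by rewrite !big_nat; apply: ler_sum => c ran_c; apply: cut.
rewrite (eq_bigr (fun a => \sum_(0 <= k < l3 | (k < l3 - b - a)%N)
    \sum_(b.+1 <= c < l3.+1) g k (a + (b + k).+1)%N c)) => [|a _]; last first.
  by rewrite exchange_big -(big_nat_widen 0 (l3 - b - a) l3 xpredT); last by lia.
(* For fixed [k], [e] ranges over [2 b + k + 1, ..., l3] and [c] over [b + 1, ..., l3]. *)
rewrite (exchange_big_dep xpredT) //=; apply: sumr_ge0 => k _.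
rewrite (eq_bigl (fun a => (a < l3.+1 - (b + k).+1)%N)) => [|a]; last by lia.
rewrite -(big_nat_widen b (l3.+1 - (b + k).+1) l2.+1 xpredT); last by lia.
rewrite -[X in 0 <= X](big_addn b l3.+1 (b + k).+1 xpredT
  (fun e => \sum_(b.+1 <= c < l3.+1) g k e c)).
apply: antisym_box_ge0 => [|e f|e f ran_e ran_f]; first by lia.
  rewrite /g det_paths3_swap12 mulrN; congr (- (_ * det_paths3 _ _ _ _ _ _ _)); lia.
by rewrite mulr_ge0 //; apply: det_paths3_ge0 => //; lia.
Qed.

(** The only possible defect in the order of the points is that the second one is to
    the left of the third. They are brought to a common diagonal, where the terms
    whose order may be wrong cancel in pairs. *)
Lemma sum_det_c_le_b_ge0 a c : (a <= l2)%N -> (c <= l3)%N ->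
  0 <= \sum_(c <= b < a.+1) T a b c.
Proof.
move=> le_a le_c.
have [le_l3|lt_l3] := leqP l3 (l2 - c)%N.
  (* The second path goes down to the diagonal of the third point. The terms that
     cancel are those with [k < b - 2 c]; the other paths reach that diagonal at
     abscissa at least [2 - c], to the right of the third point. *)
  pose g k b := 'C(l2 - c - l3, k)%:Z *
    det_paths3 be (3 + a%:Z) (l1 - a)%N (2 + c%:Z - b%:Z + k%:Z) l3
                (1 + b%:Z - a%:Z - c%:Z) l3.
  rewrite -[leLHS](@sum_antisym_triangle_nat a c l2 (fun k => (c + c + k).+1) g);
    first last.
  - move=> k b lt_k ran_b; rewrite /g det_paths3_swap23 mulrN.
    by congr (- (_ * det_paths3 _ _ _ _ _ _ _)); lia.
  - by move=> k _; lia.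
  rewrite !big_nat; apply: ler_sum => b ran_b.
  rewrite (eq_bigl (fun k => (k < b - (c + c))%N)) => [|k]; last by lia.
  rewrite -(big_nat_widen 0 (b - (c + c)) l2 xpredT); last by lia.
  have -> : T a b c = det_paths3 be (3 + a%:Z) (l1 - a)%N (2 + c%:Z - b%:Z)
      (l3 + (l2 - c - l3))%N (1 + b%:Z - a%:Z - c%:Z) l3.
    by congr det_paths3; lia.
  apply: (pascal_diag_cut (det_paths3_pascal2 _ _ _ _ _)) => j le_j.
  by apply: det_paths3_ge0 => //; lia.
(* The third path goes down to the diagonal of the second point. Here
   [k <= d <= c], so that the terms that cancel, those with [b >= 2 c + 1 - k], all
   satisfy [c <= b]. *)
pose d := (l3 - (l2 - c))%N.
pose g k b := 'C(d, k)%:Z *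
    det_paths3 be (3 + a%:Z) (l1 - a)%N (2 + c%:Z - b%:Z) (l2 - c)%N
                (1 + b%:Z - a%:Z - c%:Z + k%:Z) (l2 - c)%N.
rewrite -[leLHS](@sum_antisym_triangle_nat a c d.+1 (fun k => (c + c).+1 - k)%N g);
  first last.
- move=> k b lt_k ran_b; rewrite /g det_paths3_swap23 mulrN.
  by congr (- (_ * det_paths3 _ _ _ _ _ _ _)); lia.
- by move=> k lt_k; lia.
rewrite !big_nat; apply: ler_sum => b ran_b.
have -> : T a b c = \sum_(0 <= k < d.+1) g k b.
  rewrite -(pascal_expand _ _ _ (det_paths3_pascal3 _ _ _ _ _)).
  by congr det_paths3; lia.
rewrite [leRHS](bigID (fun k => (c + c).+1 - k <= b)%N) /= lerDl.
rewrite sumr_ge0 // => k gt_b; rewrite mulr_ge0 //.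
by apply: det_paths3_ge0 => //; lia.
Qed.

Lemma sum_det_abc_ge0 :
  0 <= \sum_(0 <= a < l2.+1) \sum_(0 <= b < a.+1) \sum_(0 <= c < l3.+1) T a b c.
Proof.
rewrite (eq_big_nat _ _ (F2 := fun a =>
  \sum_(0 <= b < l2.+1 | (b <= a)%N) \sum_(b.+1 <= c < l3.+1) T a b c +
  \sum_(0 <= c < l3.+1) \sum_(c <= b < a.+1) T a b c)) => [|a ran_a].
  rewrite big_split addr_ge0 //=.
    rewrite (exchange_big_dep xpredT) //= sumr_ge0 // => b _.
    rewrite -(big_nat_widenl b 0 _ xpredT) //; exact: sum_det_b_lt_c_ge0.
  rewrite big_nat sumr_ge0 // => a ran_a; rewrite big_nat sumr_ge0 // => c ran_c.
  by apply: sum_det_c_le_b_ge0; lia.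
rewrite (big_nat_widen 0 a.+1 l2.+1); last by lia.
rewrite [X in _ + X](eq_bigr (fun c =>
  \sum_(0 <= b < l2.+1 | ((b <= a) && (c <= b))%N) T a b c)).
  rewrite [X in _ + X](exchange_big_dep (fun b => b <= a)%N) => [|c b _ /andP[]//] /=.
  rewrite -big_split /=; apply: eq_bigr => b le_ba.
  rewrite (bigID (fun c => b.+1 <= c)%N) /=; congr (_ + _).
    by rewrite -(big_nat_widenl b.+1 0 _ xpredT).
  by apply: eq_bigl => c; lia.
move=> c _; rewrite (big_nat_widen c a.+1 l2.+1) //.
by rewrite (big_nat_widenl c 0) //.
Qed.

End ThreeRows.

(** * The points and the triangular sequences of a pair of partitions *)

Lemma part_decr p (la : p.-tuple nat) i j :
  is_partition la -> (0 < i <= j)%N -> (j <= p)%N -> (part la j <= part la i)%N.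
Proof.
move=> la_part; case: i j => [//|i] [|j] //= le_ij lt_jp.
have geq_trans : transitive geq.
  by move=> u v w /= le_uv le_wu; apply: leq_trans le_wu le_uv.
have geq_refl : reflexive geq by move=> u /=.
apply: (sorted_leq_nth geq_trans geq_refl 0%N la_part) => //.
all: by rewrite inE size_tuple; lia.
Qed.

Lemma pointB_decr p (mu : p.-tuple nat) (i j : 'I_p) :
  is_partition mu -> (i < j)%N -> (pointB mu j.+1).1 < (pointB mu i.+1).1.
Proof.
move=> mu_part lt_ij /=; have := @part_decr _ mu i.+1 j.+1 mu_part.
by have := ltn_ord j; lia.
Qed.

Lemma M_diag_paths p (la mu : p.-tuple nat) (s : Defs.family la) x n :
    (forall i : 'I_p, pointA s i.+1 = (x i, x i + (n i)%:Z)) ->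
  M mu s = diag_paths_mx x n (fun j => (pointB mu j.+1).1).
Proof. by move=> sA; apply/matrixP => i j; rewrite !mxE sA -card_paths. Qed.

Definition tri_at p i j (ij : (0 < j <= i)%N) (lt_ip : (i < p)%N) (lt_jp : (j < p)%N) :
  tri p := exist _ (Ordinal lt_ip, Ordinal lt_jp) ij.

Lemma entryE p (la : p.-tuple nat) (s : Defs.family la) i j ij lt_ip lt_jp :
  entry s i j = s (@tri_at p i j ij lt_ip lt_jp).
Proof.
rewrite /entry; case: pickP => [[[u v] /= uv] /andP[/eqP eq_u /eqP eq_v]|].
  by congr (nat_of_ord (s _)); apply: val_inj; congr pair; apply: val_inj.
by move/(_ (tri_at ij lt_ip lt_jp)); rewrite /= !eqxx.
Qed.

Lemma coef1_ge0 (la mu : 1.-tuple nat) : 0 <= coef la mu.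
Proof. by rewrite sumr_ge0 // => s _; rewrite det_mx11 mxE. Qed.

Lemma coef2_ge0 (la mu : 2.-tuple nat) :
  is_partition la -> is_partition mu -> 0 <= coef la mu.
Proof.
move=> la_part mu_part; rewrite sumr_ge0 // => s; rewrite inE => /andP[/forallP s_le _].
pose t11 := @tri_at 2 1 1 isT isT isT.
have {s_le} := s_le t11; rewrite -entryE /=; set a := entry s 1 1 => le_a.
have le_la : (part la 2 <= part la 1)%N by apply: part_decr.
pose x (i : 'I_2) : int := if i == 0 then 2 + a%:Z else 1 - a%:Z.
pose n (i : 'I_2) : nat := if i == 0 then (part la 1 - a)%N else part la 2.
rewrite (@M_diag_paths _ _ _ _ x n) => [|[[|[|//]] i_lt]].
- apply: det_diag_paths_ge0 => [|i j]; last exact: pointB_decr.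
  move=> [[|[|//]] ?] [[|[|//]] ?] //= _.
  by rewrite /x /n /=; lia.
- rewrite /pointA /= /Rsum big_geq //= /x /n /=; congr pair; lia.
- rewrite /pointA /= big_nat1 /Csum big_geq // /x /n /=; rewrite -/a.
  by congr pair; lia.
Qed.

Definition t11 : tri 3 := @tri_at 3 1 1 isT isT isT.
Definition t21 : tri 3 := @tri_at 3 2 1 isT isT isT.
Definition t22 : tri 3 := @tri_at 3 2 2 isT isT isT.

Lemma tri3_ind (P : tri 3 -> Prop) : P t11 -> P t21 -> P t22 -> forall t, P t.
Proof.
move=> P11 P21 P22 [[[[|[|[|//]]] i_lt] [[|[|[|//]]] j_lt]] ij] //.
- by rewrite (_ : exist _ _ _ = t11) //; apply: val_inj; congr pair; apply: val_inj.
- by rewrite (_ : exist _ _ _ = t21) //; apply: val_inj; congr pair; apply: val_inj.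
- by rewrite (_ : exist _ _ _ = t22) //; apply: val_inj; congr pair; apply: val_inj.
Qed.

Section Coef3.
Variables (la mu : 3.-tuple nat).

Lemma entry11 (s : Defs.family la) : entry s 1 1 = s t11. Proof. exact: entryE. Qed.
Lemma entry21 (s : Defs.family la) : entry s 2 1 = s t21. Proof. exact: entryE. Qed.

Lemma mem_triseq3 (s : Defs.family la) : is_partition la ->
  (s \in triseq la) =
  [&& s t11 < (part la 2).+1, s t21 < (s t11).+1 & s t22 < (part la 3).+1]%N.
Proof.
move=> la_part; rewrite inE !ltnS.
apply/andP/and3P => [[/forallP le_s /forallP sum_s]|[le11 le21 le22]]; split.
- exact: le_s t11.
- have /forallP/(_ (Ordinal (isT : 1 < 3)%N))/implyP := sum_s (Ordinal (isT : 1 < 3)%N).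
  by rewrite big_nat1 -(entry21 s) -(entry11 s) => /(_ isT).
- exact: le_s t22.
- by apply/forallP; apply: tri3_ind => //; apply: leq_trans le21 le11.
- apply/forallP => -[[|[|[|//]]] j_lt]; apply/forallP => -[[|[|[|//]]] i_lt] //=.
  by rewrite big_nat1 (entry21 s) (entry11 s).
Qed.

Lemma det_M3 (s : Defs.family la) : is_partition la -> s \in triseq la ->
  \det (M mu s) = det_abc (fun j => (pointB mu j.+1).1)
    (part la 1) (part la 2) (part la 3) (s t11) (s t21) (s t22).
Proof.
move=> la_part; rewrite mem_triseq3 //; rewrite -!entryE /= => /and3P[le11 le21 le22].
have le_la21 : (part la 2 <= part la 1)%N by apply: part_decr.
have le_la32 : (part la 3 <= part la 2)%N by apply: part_decr.
rewrite /det_abc /det_paths3; congr (\det _); apply: M_diag_paths.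
have R2 : Rsum s 2 = entry s 2 1 by rewrite /Rsum big_nat1.
have C1 : Csum s 1 = entry s 2 1 by rewrite /Csum big_nat1.
move=> [[|[|[|//]]] i_lt]; rewrite /pointA /sel3 /=.
- by rewrite /Rsum big_geq //; congr pair; lia.
- by rewrite R2; congr pair; lia.
- rewrite big_nat_recr //= big_nat1 C1 {1 2}/Csum big_geq //; congr pair; lia.
Qed.

Lemma coef3_ge0 : is_partition la -> is_partition mu -> 0 <= coef la mu.
Proof.
move=> la_part mu_part.
have le_la21 : (part la 2 <= part la 1)%N by apply: part_decr.
have le_la32 : (part la 3 <= part la 2)%N by apply: part_decr.
set l1 := part la 1; pose I := 'I_l1.+1.
pose fam (v : I * (I * I)) : Defs.family la :=
  [ffun t : tri 3 => if ((val t).1 == 1 :> nat)%N then v.1 else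
     if ((val t).2 == 1 :> nat)%N then v.2.1 else v.2.2].
have fam_bij : bijective fam.
  exists (fun s : Defs.family la => (s t11, (s t21, s t22))) => [[a [b c]]|s].
    by rewrite !ffunE.
  by apply/ffunP; apply: tri3_ind; rewrite ffunE.
rewrite /coef (eq_bigr _ (fun s => @det_M3 s la_part)).
rewrite (reindex fam) /=; last exact: onW_bij.
rewrite (eq_bigl _ _ (fun v => mem_triseq3 (fam v) la_part)).
under eq_bigl => v do rewrite !ffunE /=.
under eq_bigr => v _ do rewrite !ffunE /=.
set be := fun j : 'I_3 => _.
rewrite -(pair_big_dep (fun a : I => a < (part la 2).+1)%N
  (fun (a : I) (bc : I * I) => (bc.1 < a.+1) && (bc.2 < (part la 3).+1))%N
  (fun a bc => det_abc be l1 (part la 2) (part la 3) a bc.1 bc.2)) /=.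
have nat_sum m (F : nat -> int) : (m <= l1)%N ->
    \sum_(a < l1.+1 | (a < m.+1)%N) F a = \sum_(0 <= a < m.+1) F a.
  by move=> le_m; rewrite big_mkord -big_ord_widen.
rewrite (eq_bigr (fun a : I => \sum_(0 <= b < a.+1) \sum_(0 <= c < (part la 3).+1)
  det_abc be l1 (part la 2) (part la 3) a b c)) => [|a _].
  rewrite (nat_sum _ (fun a => \sum_(0 <= b < a.+1) \sum_(0 <= c < (part la 3).+1)
    det_abc be l1 (part la 2) (part la 3) a b c)) //.
  by apply: sum_det_abc_ge0 => // i j; apply: pointB_decr.
rewrite -(pair_big (fun b : I => b < a.+1)%N (fun c : I => c < (part la 3).+1)%N
  (fun b c => det_abc be l1 (part la 2) (part la 3) a b c)) /=.
rewrite -nat_sum; last by rewrite -ltnS.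
by apply: eq_bigr => b _; rewrite -nat_sum //; apply: leq_trans le_la21.
Qed.
End Coef3.

Theorem theorem2p1 (p : nat) (la mu : p.-tuple nat)
    (p_gt0 : (0 < p)%N) (p_le3 : (p <= 3)%N)
    (la_part : is_partition la) (mu_part : is_partition mu) :
  0 <= coef la mu.
Proof.
case: p => [|[|[|[|//]]]] // in p_gt0 p_le3 la mu la_part mu_part *.
- exact: coef1_ge0.
- exact: coef2_ge0.
- exact: coef3_ge0.
Qed.
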